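(* Let $(\mu(A_0,c_0),J,g)$ be a strongly unimodular $2n$-dimensional SKT almost nilpotent Lie algebra. Then the solution to the bracket flow starting from the bracket $\mu(A_0,c_0)$ is of the form $\mu(t)=\mu(A_0,c(t))$, with $$c(t)=\frac{c_0}{\sqrt{1+2c_0^2t}},\qquad t\in\left(-\frac{1}{2c_0^2},\infty\right).$$ In particular, the limit $(\mu_\infty,J,g)$, $\mu_\infty=\lim_{t\to\infty}\mu(t)$, is a flat Kähler almost abelian Lie algebra.
   Context: On $\mathbb{R}^{2n}$ ($n\ge2$) with standard basis $\{e_1,\dots,e_{2n}\}$ let $g$ be the standard inner product, $Je_1=e_{2n}$, $Je_{2l}=e_{2l+1}$ for $l=1,\dots,n-1$, $\omega=g(J\cdot,\cdot)$, $\mathfrak{k}_1=\mathbb{R}\langle e_2,\dots,e_{2n-1}\rangle$. For $c\in\mathbb{R}\setminus\{0\}$ and $A\in\mathfrak{gl}(\mathfrak{k}_1)$ commuting with $J|_{\mathfrak{k}_1}$, skew-symmetric with respect to $g$, and satisfying $A^*e^{23}=0$ (where $(A^*\sigma)(X,Y)=\sigma(AX,Y)+\sigma(X,AY)$, $e^{23}=e^2\wedge e^3$), $\mu(A,c)\in\Lambda^2(\mathbb{R}^{2n})^*\otimes\mathbb{R}^{2n}$ is the Lie bracket with $[e_{2n},e_1]=0$, $[e_{2n},X]=AX$, $[X,Y]=-c\,e^{23}(X,Y)e_1$, $[e_1,X]=0$ for $X,Y\in\mathfrak{k}_1$; the nilradical is $\mathbb{R}\langle e_1,\dots,e_{2n-1}\rangle$.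 These are, up to equivalence, exactly the strongly unimodular almost nilpotent SKT Lie algebras (SKT: $J$ integrable, $dd^c\omega=0$) whose nilradical $\mathfrak{n}$ has one-dimensional commutator $\mathfrak{n}^1$ and which satisfy $J\mathfrak{n}^1=\mathfrak{n}^{\perp_g}$. Bracket flow: for a Lie bracket $\mu$ on $\mathbb{R}^{2n}$ with $J$ integrable, extend $(J,g)$ left-invariantly to the corresponding Lie group, let $\nabla^B$ be the Bismut connection (the unique Hermitian connection with totally skew-symmetric torsion), with curvature $R^B(X,Y)=[\nabla^B_X,\nabla^B_Y]-\nabla^B_{[X,Y]}$, and let $\rho^B_\mu(X,Y)=-\frac12\sum_{l=1}^{2n}g(R^B(X,Y)e_l,Je_l)$ at the identity. Let $P_\mu=\frac12\omega^{-1}(\rho^B_\mu)^{1,1}\in\mathfrak{gl}_{2n}$, i.e. $(\rho^B_\mu)^{1,1}(X,Y)=2\omega(P_\mu X,Y)$. The bracket flow is $\frac{d}{dt}\mu=-\pi(P_\mu)\mu$, $\mu(0)=\mu_0$, where $(\pi(C)\mu)(X,Y)=C\mu(X,Y)-\mu(CX,Y)-\mu(X,CY)$. It corresponds, up to time-dependent biholomorphisms, to the pluriclosed flow $\frac{d}{dt}\omega(t)=-(\rho^B_{\omega(t)})^{1,1}$. Almost abelian: having a codimension-one abelian ideal. *)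

(* Defs.v *)
(* MathComp / MathComp-Analysis *)
From HB Require Import structures.
From mathcomp Require Import all_boot all_order all_algebra.
From mathcomp Require Import sesquilinear.
From mathcomp Require Import all_classical all_reals all_analysis.

Set Implicit Arguments.
Unset Strict Implicit.
Unset Printing Implicit Defensive.
Import Order.TTheory GRing.Theory Num.Theory numFieldNormedType.Exports.
Local Open Scope classical_set_scope.
Local Open Scope ring_scope.

(* The vectors e_1, ..., e_{2n} are numbered from 1; evec n k is 0 when k is
   not in {1, ..., 2n}. *)
Definition evec (R : realType) (n k : nat) : 'cV[R]_(2 * n) :=
  \col_i (i.+1 == k)%:R.
Arguments evec {R n} k.

Definition inner (R : realType) (n : nat) (X Y : 'cV[R]_(2 * n)) : R :=
  \sum_i X i 0 * Y i 0.

(* J e_1 = e_{2n}, J e_{2l} = e_{2l+1} for 1 <= l <= n-1, and J^2 = -1. *)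
Definition Jmx (R : realType) (n : nat) : 'M[R]_(2 * n) :=
  evec (2 * n) *m (evec 1)^T - evec 1 *m (evec (2 * n))^T
  + \sum_(1 <= l < n) (evec (2 * l).+1 *m (evec (2 * l))^T
                       - evec (2 * l) *m (evec (2 * l).+1)^T).
Arguments Jmx {R n}.

Definition omega (R : realType) (n : nat) (X Y : 'cV[R]_(2 * n)) : R :=
  inner (Jmx *m X) Y.

Definition k1 (R : realType) (n : nat) : {vspace 'cV[R]_(2 * n)} :=
  (\sum_(2 <= k < 2 * n) <[evec k]>)%VS.

Definition e23 (R : realType) (n : nat) (X Y : 'cV[R]_(2 * n)) : R :=
  inner X (evec 2) * inner Y (evec 3) - inner X (evec 3) * inner Y (evec 2).

(* gl(k_1) is identified with the 2n x 2n matrices that preserve k_1 and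
   vanish on e_1 and e_{2n}. *)
Definition in_gl_k1 (R : realType) (n : nat) (A : 'M[R]_(2 * n)) : Prop :=
  [/\ {in k1 R n, forall X, A *m X \in k1 R n},
      A *m evec 1 = 0 & A *m evec (2 * n) = 0].

Definition admissible (R : realType) (n : nat) (A : 'M[R]_(2 * n)) : Prop :=
  [/\ in_gl_k1 A,
      {in k1 R n, forall X, A *m (Jmx *m X) = Jmx *m (A *m X)},
      {in k1 R n &, forall X Y, inner (A *m X) Y = - inner X (A *m Y)} &
      {in k1 R n &, forall X Y, e23 (A *m X) Y + e23 X (A *m Y) = 0}].

Definition bracket (R : realType) (n : nat) :=
  'cV[R]_(2 * n) -> 'cV[R]_(2 * n) -> 'cV[R]_(2 * n).

(* For A vanishing on e_1 and e_{2n}, this is the bilinear alternating map with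
   [e_{2n}, e_1] = 0 and, for X, Y in k_1, [e_{2n}, X] = A X,
   [X, Y] = - c e^{23}(X, Y) e_1 and [e_1, X] = 0. *)
Definition muAc (R : realType) (n : nat) (A : 'M[R]_(2 * n)) (c : R) :
    bracket R n :=
  fun X Y => inner X (evec (2 * n)) *: (A *m Y)
             - inner Y (evec (2 * n)) *: (A *m X)
             - (c * e23 X Y) *: evec 1.

Section Lie.
Context {R : realType} {n : nat}.
Local Notation V := 'cV[R]_(2 * n).
Implicit Types (mu nabla : bracket R n) (U W : {vspace V}) (X Y Z T : V).

Definition bilin mu : Prop := bilinear_for *:%R *:%R mu.

Definition is_lie mu : Prop :=
  [/\ bilin mu,
      forall X, mu X X = 0 &
      forall X Y Z, mu X (mu Y Z) + mu Y (mu Z X) + mu Z (mu X Y) = 0].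

Definition ideal mu U : Prop := forall X Y, Y \in U -> mu X Y \in U.

Definition brackv mu U W : {vspace V} :=
  <<[seq mu X Y | X <- vbasis U, Y <- vbasis W]>>%VS.

(* Descending central series, starting at lcs mu U 0 = U. *)
Fixpoint lcs mu U (k : nat) : {vspace V} :=
  if k is j.+1 then brackv mu U (lcs mu U j) else U.

Definition nilpotent_ideal mu U : Prop :=
  ideal mu U /\ exists k, lcs mu U k = 0%VS.

Definition nilradical mu U : Prop :=
  nilpotent_ideal mu U /\ forall W, nilpotent_ideal mu W -> (W <= U)%VS.

Definition almost_nilpotent mu : Prop :=
  exists U, nilradical mu U /\ (\dim U).+1 = (2 * n)%N.

Definition almost_abelian mu : Prop :=
  exists U, [/\ ideal mu U, {in U &, forall X Y, mu X Y = 0} &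
                (\dim U).+1 = (2 * n)%N].

(* Trace of the restriction of ad X to an (ad X)-invariant subspace U. *)
Definition tr_ad mu X U : R :=
  \sum_(i < \dim U) coord (vbasis U) i (mu X (vbasis U)`_i).

(* The trace of ad X on every quotient n^i / n^{i+1} of the descending central
   series of the nilradical n vanishes; the trace on a quotient by an invariant
   subspace is the difference of the two traces. *)
Definition strongly_unimodular mu : Prop :=
  exists U, nilradical mu U /\
    forall X i, tr_ad mu X (lcs mu U i) - tr_ad mu X (lcs mu U i.+1) = 0.

Definition integrable_J mu : Prop :=
  forall X Y, mu (Jmx *m X) (Jmx *m Y) - Jmx *m mu (Jmx *m X) Y
              - Jmx *m mu X (Jmx *m Y) - mu X Y = 0.

(* Exterior derivatives of left-invariant 2-forms and 3-forms. *)
Definition d2 mu (a : V -> V -> R) X Y Z : R :=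
  - a (mu X Y) Z + a (mu X Z) Y - a (mu Y Z) X.

Definition d3 mu (a : V -> V -> V -> R) X Y Z T : R :=
  - a (mu X Y) Z T + a (mu X Z) Y T - a (mu X T) Y Z
  - a (mu Y Z) X T + a (mu Y T) X Z - a (mu Z T) X Y.

(* d^c omega = - d omega (J ., J ., J .), for J integrable. *)
Definition dc_omega mu X Y Z : R :=
  - d2 mu (@omega R n) (Jmx *m X) (Jmx *m Y) (Jmx *m Z).

Definition skt mu : Prop :=
  [/\ is_lie mu, integrable_J mu &
      forall X Y Z T, d3 mu (dc_omega mu) X Y Z T = 0].

Definition kahler mu : Prop :=
  integrable_J mu /\ forall X Y Z, d2 mu (@omega R n) X Y Z = 0.

(* Left-invariant connections on the Lie group of mu are the bilinear maps
   (X, Y) |-> nabla_X Y on the Lie algebra. *)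
Definition torsion mu nabla X Y : V := nabla X Y - nabla Y X - mu X Y.

Definition curvature mu nabla X Y Z : V :=
  nabla X (nabla Y Z) - nabla Y (nabla X Z) - nabla (mu X Y) Z.

Definition metric_connection nabla : Prop :=
  forall X Y Z, inner (nabla X Y) Z + inner Y (nabla X Z) = 0.

Definition levi_civita mu nabla : Prop :=
  [/\ bilin nabla, metric_connection nabla &
      forall X Y, torsion mu nabla X Y = 0].

Definition flat mu : Prop :=
  exists nabla, levi_civita mu nabla /\
    forall X Y Z, curvature mu nabla X Y Z = 0.

Definition skew3 (a : V -> V -> V -> R) : Prop :=
  forall X Y Z, a X Y Z = - a Y X Z /\ a X Y Z = - a X Z Y.

Definition bismut mu nabla : Prop :=
  [/\ bilin nabla,
      metric_connection nabla,
      forall X Y, nabla X (Jmx *m Y) = Jmx *m nabla X Y &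
      skew3 (fun X Y Z => inner (torsion mu nabla X Y) Z)].

Definition ricci_form mu nabla X Y : R :=
  - 2^-1 * \sum_(1 <= l < (2 * n).+1)
     inner (curvature mu nabla X Y (evec l)) (Jmx *m evec l).

Definition part11 (a : V -> V -> R) X Y : R :=
  2^-1 * (a X Y + a (Jmx *m X) (Jmx *m Y)).

(* P = P_mu, with the Bismut connection characterised by its defining
   properties. *)
Definition is_Pmu mu (P : 'M[R]_(2 * n)) : Prop :=
  exists nabla, bismut mu nabla /\
    forall X Y, part11 (ricci_form mu nabla) X Y = 2 * omega (P *m X) Y.

Definition pi_act (C : 'M[R]_(2 * n)) mu : bracket R n :=
  fun X Y => C *m mu X Y - mu (C *m X) Y - mu X (C *m Y).

(* nu solves the bracket flow d/dt nu = - pi(P_nu) nu, nu(0) = mu0, on the open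
   interval of times D; the derivative in the finite-dimensional space of
   brackets is taken argumentwise. *)
Definition bracket_flow (mu0 : bracket R n) (D : set R)
    (nu : R -> bracket R n) : Prop :=
  [/\ open D, is_interval D, D 0, nu 0 = mu0 &
      forall t, D t ->
        [/\ is_lie (nu t), integrable_J (nu t) &
            exists2 P, is_Pmu (nu t) P &
              forall X Y, is_derive (t : R^o) (1 : R^o)
                            (fun s : R^o => nu s X Y)
                            (- pi_act P (nu t) X Y)]].

(* nu, with maximal interval of existence D, is the solution with initial value
   mu0: every solution is a restriction of nu. *)
Definition the_bracket_flow (mu0 : bracket R n) (D : set R)
    (nu : R -> bracket R n) : Prop :=
  bracket_flow mu0 D nu /\
  forall (D' : set R) (nu' : R -> bracket R n), bracket_flow mu0 D' nu' ->
    D' `<=` D /\ forall t, D' t -> nu' t = nu t.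

End Lie.

(* Main.v *)
(* The Bismut connection of mu(A, c) is
   nabla_X Y = c x_1 K Y + x_{2n} A Y, where K is J composed with the
   orthogonal projection pr onto the span of e_2 and e_3.  Since A, J and K
   commute, its curvature is c^2 e^{23}(X, Y) K, so that rho^B = - c^2 e^{23}
   and P = - (c^2 / 2) pr.  P acts on mu(A, c) only through c,
   and the flow reduces to c' = - c^3.

   For uniqueness, the torsion of a Bismut connection of any integrable bracket
   mu is d omega (J ., J ., J .), hence by Koszul's formula nabla is linear in
   mu.  So P_mu is quadratic in mu, the flow is an ordinary differential
   equation with polynomial, locally Lipschitz right-hand side, and Gronwall's
   inequality applies.  The solution is maximal because c blows up at
   - 1 / (2 c_0^2), while any solution is bounded on compact time intervals. *)
Require Import Defs.
From HB Require Import structures.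
From mathcomp Require Import all_boot all_order all_algebra.
From mathcomp Require Import all_classical all_reals all_analysis.
From mathcomp Require Import sesquilinear ring lra zify.
Import Order.TTheory GRing.Theory Num.Theory numFieldNormedType.Exports.
Local Open Scope classical_set_scope.
Local Open Scope ring_scope.

(** * The Hermitian structure *)

Section HermitianSpace.
Context {R : realType} {n : nat}.
Local Notation V := 'cV[R]_(2 * n).
Local Notation J := (@Jmx R n).
Implicit Types (X Y Z : V) (a : R) (A : 'M[R]_(2 * n)).

Lemma innerE X Y : inner X Y = (X^T *m Y) 0 0.
Proof. by rewrite /inner mxE; apply: eq_bigr => i _; rewrite mxE. Qed.

Lemma innerC X Y : inner X Y = inner Y X.
Proof. by apply: eq_bigr => i _; rewrite mulrC. Qed.

Lemma innerDl X Y Z : inner (X + Y) Z = inner X Z + inner Y Z.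
Proof. by rewrite /inner -big_split; apply: eq_bigr => i _;
  rewrite mxE mulrDl. Qed.

Lemma innerDr X Y Z : inner X (Y + Z) = inner X Y + inner X Z.
Proof. by rewrite !(innerC X) innerDl. Qed.

Lemma innerZl a X Y : inner (a *: X) Y = a * inner X Y.
Proof. by rewrite /inner mulr_sumr; apply: eq_bigr => i _; rewrite mxE mulrA. Qed.

Lemma innerZr a X Y : inner X (a *: Y) = a * inner X Y.
Proof. by rewrite !(innerC X) innerZl. Qed.

Lemma innerNl X Y : inner (- X) Y = - inner X Y.
Proof. by rewrite -scaleN1r innerZl mulN1r. Qed.

Lemma innerNr X Y : inner X (- Y) = - inner X Y.
Proof. by rewrite !(innerC X) innerNl. Qed.

Lemma inner0l Y : inner 0 Y = 0.
Proof. by rewrite -(scale0r 0) innerZl mul0r. Qed.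

Lemma inner0r X : inner X 0 = 0.
Proof. by rewrite innerC inner0l. Qed.

Definition inner_lin :=
  (innerDl, innerDr, innerZl, innerZr, innerNl, innerNr, inner0l, inner0r).

Lemma inner_mulmxl A X Y : inner (A *m X) Y = inner X (A^T *m Y).
Proof. by rewrite !innerE trmx_mul mulmxA. Qed.

Lemma inner_delta X i : inner X (delta_mx i 0) = X i 0.
Proof.
rewrite /inner (bigD1 i)//= big1 => [|j ji]; last by rewrite mxE (negPf ji) mulr0.
by rewrite mxE !eqxx mulr1 addr0.
Qed.

Lemma evec_delta (i : 'I_(2 * n)) : evec i.+1 = delta_mx i 0 :> V.
Proof. by apply/colP => j; rewrite !mxE eqSS andbT. Qed.

Lemma evecP k : (1 <= k <= 2 * n)%N ->
  exists2 i : 'I_(2 * n), k = i.+1 & evec k = delta_mx i 0 :> V.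
Proof.
case: k => // k /andP[_ kn]; exists (Ordinal kn) => //.
by rewrite -evec_delta.
Qed.

Lemma evec_tr_mul k l : (1 <= k <= 2 * n)%N ->
  (evec k : V)^T *m evec l = ((k == l)%:R)%:M.
Proof.
move=> /evecP[i -> ->]; apply/matrixP => x y;
  rewrite !ord1 -innerE innerC inner_delta.
by rewrite !mxE eqxx mulr1n.
Qed.

Lemma inner_evec k l : (1 <= k <= 2 * n)%N ->
  inner (evec k : V) (evec l) = (k == l)%:R.
Proof. by move=> h; rewrite innerE evec_tr_mul// mxE eqxx. Qed.

Lemma mul_evec_tr_evec k l m : (1 <= l <= 2 * n)%N ->
  (evec k : V) *m (evec l : V)^T *m evec m = (l == m)%:R *: evec k :> V.
Proof. by move=> h; rewrite -mulmxA evec_tr_mul// mul_mx_scalar. Qed.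

Lemma Jmx_evec m : (2 <= n)%N -> J *m evec m =
  (m == 1)%:R *: evec (2 * n) - (m == 2 * n)%:R *: evec 1
  + \sum_(1 <= l < n) ((m == (2 * l))%:R *: evec (2 * l).+1
    - (m == (2 * l).+1)%:R *: evec (2 * l)).
Proof.
move=> hn; rewrite /Jmx !mulmxDl mulNmx mulmx_suml !mul_evec_tr_evec; try lia.
rewrite ![_ == m]eq_sym; congr (_ + _).
rewrite big_seq [RHS]big_seq; apply: eq_bigr => l; rewrite mem_index_iota => hl.
by rewrite mulmxDl mulNmx !mul_evec_tr_evec ?[_ == m]eq_sym//; lia.
Qed.

Hypothesis hn : (2 <= n)%N.

Lemma Jmx_evec1 : J *m evec 1 = evec (2 * n).
Proof.
rewrite Jmx_evec// eqxx scale1r.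
rewrite (_ : (1 == 2 * n)%N = false) ?scale0r ?subr0; last by lia.
rewrite big_seq big1 ?addr0// => l; rewrite mem_index_iota => hl.
rewrite (_ : (1 == 2 * l)%N = false)
  1?(_ : (1 == (2 * l).+1)%N = false) ?scale0r ?subr0//; lia.
Qed.

Lemma Jmx_evec_last : J *m evec (2 * n) = - evec 1.
Proof.
rewrite Jmx_evec// eqxx scale1r.
rewrite (_ : (2 * n == 1)%N = false) ?scale0r ?sub0r; last by lia.
rewrite big_seq big1 ?addr0// => l; rewrite mem_index_iota => hl.
rewrite (_ : (2 * n == 2 * l)%N = false)
  1?(_ : (2 * n == (2 * l).+1)%N = false) ?scale0r ?subr0//; lia.
Qed.

Lemma Jmx_evec_even l : (1 <= l < n)%N -> J *m evec (2 * l) = evec (2 * l).+1.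
Proof.
move=> hl; rewrite Jmx_evec//.
rewrite (_ : (2 * l == 1)%N = false) 1?(_ : (2 * l == 2 * n)%N = false); [|lia..].
rewrite !scale0r subr0 add0r (bigD1_seq l) ?mem_index_iota ?iota_uniq//=.
rewrite eqxx scale1r (_ : (2 * l == (2 * l).+1)%N = false) ?scale0r ?subr0;
  last by lia.
rewrite big_seq_cond big1 ?addr0// => m; rewrite mem_index_iota => hm.
rewrite (_ : (2 * l == 2 * m)%N = false)
  1?(_ : (2 * l == (2 * m).+1)%N = false) ?scale0r ?subr0//; lia.
Qed.

Lemma Jmx_evec_odd l : (1 <= l < n)%N -> J *m evec (2 * l).+1 = - evec (2 * l).
Proof.
move=> hl; rewrite Jmx_evec//.
rewrite (_ : ((2 * l).+1 == 1)%N = false)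
  1?(_ : ((2 * l).+1 == 2 * n)%N = false); [|lia..].
rewrite !scale0r subr0 add0r (bigD1_seq l) ?mem_index_iota ?iota_uniq//=.
rewrite eqxx scale1r (_ : ((2 * l).+1 == 2 * l)%N = false) ?scale0r ?sub0r;
  last by lia.
rewrite big_seq_cond big1 ?addr0// => m; rewrite mem_index_iota => hm.
rewrite (_ : ((2 * l).+1 == 2 * m)%N = false)
  1?(_ : ((2 * l).+1 == (2 * m).+1)%N = false) ?scale0r ?subr0//; lia.
Qed.

(** The indices are grouped by the [J]-invariant planes: e_1 with e_{2n}, and e_{2l} with
    e_{2l+1}. *)
Lemma evec_cases (Q : nat -> Prop) :
  Q 1%N -> Q (2 * n)%N ->
  (forall l, (1 <= l < n)%N -> Q (2 * l)%N /\ Q (2 * l).+1) ->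
  forall k, (1 <= k <= 2 * n)%N -> Q k.
Proof.
move=> Q1 Q2 Q3 k hk.
have [->//|k1] := eqVneq k 1%N; have [->//|k2] := eqVneq k (2 * n)%N.
have hl : (1 <= k./2 < n)%N by lia.
have [Qe Qo] := Q3 _ hl.
by have [->|->] : k = (2 * k./2)%N \/ k = (2 * k./2).+1 by lia.
Qed.

Lemma mulmx_evec_inj A B : (forall k, (1 <= k <= 2 * n)%N ->
  A *m evec k = B *m evec k :> V) -> A = B.
Proof.
move=> h; apply/matrixP => i j.
have := h j.+1 (ltn_ord j); rewrite evec_delta -!colE.
by move=> /colP/(_ i); rewrite !mxE.
Qed.

Lemma JmxJ : J *m J = - 1%:M.
Proof.
apply: mulmx_evec_inj => k hk; rewrite mulNmx mul1mx -mulmxA; move: k hk.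
apply: (evec_cases (fun k => J *m (J *m evec k) = - evec k)).
  by rewrite Jmx_evec1 Jmx_evec_last.
  by rewrite Jmx_evec_last mulmxN Jmx_evec1.
by move=> l hl; rewrite Jmx_evec_even// Jmx_evec_odd// mulmxN Jmx_evec_even.
Qed.

Lemma JJ X : J *m (J *m X) = - X.
Proof. by rewrite mulmxA JmxJ mulNmx mul1mx. Qed.

Lemma trJmx : J^T = - J.
Proof.
rewrite /Jmx linearD linearB /= !trmx_mul !trmxK raddf_sum/= opprD opprB;
  congr (_ + _).
by rewrite -sumrN; apply: eq_bigr => l _;
  rewrite linearB /= !trmx_mul !trmxK opprB.
Qed.

Lemma inner_Jl X Y : inner (J *m X) Y = - inner X (J *m Y).
Proof. by rewrite inner_mulmxl trJmx mulNmx innerNr. Qed.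

Lemma inner_JJ X Y : inner (J *m X) (J *m Y) = inner X Y.
Proof. by rewrite inner_Jl JJ innerNr opprK. Qed.

End HermitianSpace.

Section Columns.
Context {R : realType} {m : nat}.
Implicit Types X Y : 'cV[R]_m.

Lemma colDE X Y k : (X + Y) k 0 = X k 0 + Y k 0. Proof. by rewrite mxE. Qed.
Lemma colNE X k : (- X) k 0 = - X k 0. Proof. by rewrite mxE. Qed.
Lemma colZE a X k : (a *: X) k 0 = a * X k 0. Proof. by rewrite mxE. Qed.
Lemma col0E k : (0 : 'cV[R]_m) k 0 = 0. Proof. by rewrite mxE. Qed.

Definition col_lin := (colDE, colNE, colZE, col0E).
End Columns.

(** * The endomorphism dual to e^{23} *)

Section Kmx.
Context {R : realType} {n : nat}.
Hypothesis hn : (2 <= n)%N.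
Local Notation V := 'cV[R]_(2 * n).
Local Notation J := (@Jmx R n).
Local Notation e1 := (evec 1 : V).
Local Notation e2 := (evec 2 : V).
Local Notation e3 := (evec 3 : V).
Local Notation e2n := (evec (2 * n) : V).
Implicit Types (X Y Z : V) (a c : R) (A : 'M[R]_(2 * n)).

(* The endomorphism with e^{23}(X, Y) = g(Kmx X, Y), i.e. J composed with the
   orthogonal projection onto the span of e_2 and e_3. *)
Definition Kmx : 'M[R]_(2 * n) := e3 *m e2^T - e2 *m e3^T.
Local Notation K := Kmx.

Lemma Kmx_mul X : K *m X = inner X e2 *: e3 - inner X e3 *: e2.
Proof.
have E (U W : V) : U *m W^T *m X = inner X W *: U.
  by rewrite -mulmxA (mx11_scalar (W^T *m X)) -innerE mul_mx_scalar innerC.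
by rewrite mulmxBl !E.
Qed.

Lemma e23_inner X Y : e23 X Y = inner (K *m X) Y.
Proof.
rewrite Kmx_mul !inner_lin /e23 !(innerC (evec _) Y); ring.
Qed.

Lemma Jmx_e2 : J *m e2 = e3.
Proof. by rewrite (@Jmx_evec_even _ _ hn 1)//; lia. Qed.

Lemma Jmx_e3 : J *m e3 = - e2.
Proof. by rewrite (@Jmx_evec_odd _ _ hn 1)//; lia. Qed.

Lemma trKmx : K^T = - K.
Proof. by rewrite /Kmx linearB /= !trmx_mul !trmxK opprB. Qed.

Lemma inner_Kl X Y : inner (K *m X) Y = - inner X (K *m Y).
Proof. by rewrite inner_mulmxl trKmx mulNmx innerNr. Qed.

Lemma KmxJ X : K *m (J *m X) = J *m (K *m X).
Proof.
rewrite !Kmx_mul !inner_Jl Jmx_e2 Jmx_e3 mulmxBr -!scalemxAr Jmx_e2 Jmx_e3.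
by rewrite innerNr opprK scaleNr scalerN addrC.
Qed.

(** With K = J pr and pr a projection commuting with J, both sides are - pr X. *)
Lemma KmxK X : K *m (K *m X) = J *m (K *m X).
Proof.
rewrite [in LHS]Kmx_mul inner_Kl (inner_Kl X e3) !Kmx_mul !inner_evec; try lia.
by rewrite /= mulmxBr -!scalemxAr Jmx_e2 Jmx_e3 !(scale1r, scale0r) subr0 sub0r
  innerNr opprK scaleNr scalerN addrC.
Qed.

Lemma Kmx_ortho k : (1 <= k <= 2 * n)%N -> k != 2%N -> k != 3%N ->
  K *m evec k = 0.
Proof.
move=> h /negPf h2 /negPf h3.
by rewrite Kmx_mul !inner_evec// h2 h3 !scale0r subrr.
Qed.

Lemma Kmx_e1 : K *m e1 = 0. Proof. apply: Kmx_ortho; lia. Qed.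
Lemma Kmx_e2n : K *m e2n = 0. Proof. apply: Kmx_ortho; lia. Qed.

Lemma inner_K_e1 X : inner (K *m X) e1 = 0.
Proof. by rewrite inner_Kl Kmx_e1 inner0r oppr0. Qed.

Lemma inner_K_e2n X : inner (K *m X) e2n = 0.
Proof. by rewrite inner_Kl Kmx_e2n inner0r oppr0. Qed.

Lemma inner_J_e2n X : inner (J *m X) e2n = inner X e1.
Proof. by rewrite inner_Jl Jmx_evec_last// innerNr opprK. Qed.

Lemma inner_e1_e2n : inner e1 e2n = 0.
Proof.
rewrite inner_evec; last by lia.
by have -> : (1 == 2 * n)%N = false by lia.
Qed.

(** Only l = 2 and l = 3 contribute, each giving 1. The total 2 cancels the factor 1/2 of
    [ricci_form]. *)
Lemma trace_KJ :
  \sum_(1 <= l < (2 * n).+1) inner (K *m (evec l : V)) (J *m evec l) = 2.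
Proof.
have E l : (1 <= l <= 2 * n)%N ->
    inner (K *m (evec l : V)) (J *m evec l) = (l == 2)%:R + (l == 3)%:R.
  move=> hl; rewrite Kmx_mul !inner_lin !(innerC _ (J *m _)) !inner_Jl.
  rewrite Jmx_e2 Jmx_e3 innerNr !inner_evec//.
  by case: (l == 2)%N; case: (l == 3)%N; rewrite /=; ring.
rewrite big_nat (eq_bigr (fun l => (l == 2)%:R + (l == 3)%:R)); last first.
  by move=> l hl; apply: E; lia.
rewrite -big_nat big_split /=.
rewrite (bigD1_seq 2)/= ?mem_index_iota ?iota_uniq//; last by lia.
rewrite [X in _ + X](bigD1_seq 3)/= ?mem_index_iota ?iota_uniq//; last by lia.
rewrite !big1; first by ring.
  by move=> i /negPf->.
by move=> i /negPf->.
Qed.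

End Kmx.

(** * The brackets mu(A, c) *)

Section Admissible.
Context {R : realType} {n : nat}.
Hypothesis hn : (2 <= n)%N.
Local Notation V := 'cV[R]_(2 * n).
Local Notation J := (@Jmx R n).
Local Notation K := (@Kmx R n).
Local Notation e1 := (evec 1 : V).
Local Notation e2n := (evec (2 * n) : V).
Context {A : 'M[R]_(2 * n)}.
Hypothesis hA : admissible A.
Implicit Types (X Y Z : V) (a c : R).

Lemma mem_k1 k : (2 <= k < 2 * n)%N -> (evec k : V) \in k1 R n.
Proof.
move=> hk; rewrite /k1 (bigD1_seq k) ?mem_index_iota ?iota_uniq//=.
by apply: (subvP (addvSl _ _)); rewrite memv_line.
Qed.

Lemma inner_k1_evec X k : X \in k1 R n -> (k = 1%N \/ k = (2 * n)%N) ->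
  inner X (evec k) = 0.
Proof.
move=> + hk.
have kr : (1 <= k <= 2 * n)%N by case: hk => ->; lia.
rewrite /k1 big_nat.
elim/big_rec : _ X => [X|i W hi IH X].
  by rewrite memv0 => /eqP ->; rewrite inner0l.
move=> /memv_addP[Y /vlineP[a ->]] [Z hZ ->].
rewrite innerDl innerZl (IH _ hZ) addr0 inner_evec; last by lia.
by rewrite (_ : (i == k) = false) ?mulr0//; case: hk => ->; lia.
Qed.

Lemma k1_cases (Q : nat -> Prop) : Q 1%N -> Q (2 * n)%N ->
  (forall k, (2 <= k < 2 * n)%N -> Q k) -> forall k, (1 <= k <= 2 * n)%N -> Q k.
Proof.
move=> Q1 Q2 Q3 k hk.
have [->//|k1] := eqVneq k 1%N; have [->//|k2] := eqVneq k (2 * n)%N.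
by apply: Q3; lia.
Qed.

Lemma inner_evec_inj X Y :
  (forall k, (1 <= k <= 2 * n)%N -> inner X (evec k) = inner Y (evec k)) -> X = Y.
Proof.
move=> h; apply/colP => i; have := h i.+1 (ltn_ord i).
by rewrite evec_delta !inner_delta.
Qed.

Lemma admissible_e1 : A *m e1 = 0. Proof. by case: hA => -[]. Qed.
Lemma admissible_e2n : A *m e2n = 0. Proof. by case: hA => -[]. Qed.

Lemma admissible_k1 k : (1 <= k <= 2 * n)%N -> A *m (evec k : V) \in k1 R n.
Proof.
move: k; apply: (k1_cases (fun k => A *m (evec k : V) \in k1 R n)).
- by rewrite admissible_e1 mem0v.
- by rewrite admissible_e2n mem0v.
by move=> k hk; case: hA => -[+ _ _] _ _ _; apply; exact: mem_k1.
Qed.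

(** Skew-symmetry is assumed on k_1 only. It extends to the whole space because A kills e_1 and
    e_{2n} and its image lies in k_1, orthogonal to both. *)
Lemma tr_admissible : A^T = - A.
Proof.
apply: mulmx_evec_inj => k hk; apply: inner_evec_inj => l hl.
rewrite innerC -inner_mulmxl mulNmx innerNl; move: k hk l hl.
have H k l : (k = 1%N \/ k = (2 * n)%N) -> (1 <= l <= 2 * n)%N ->
  inner (A *m (evec l : V)) (evec k) = 0.
  by move=> hk hl; apply: inner_k1_evec hk; exact: admissible_k1.
apply: (@k1_cases (fun k => forall l, (1 <= l <= 2 * n)%N ->
   inner (A *m (evec l : V)) (evec k) = - inner (A *m (evec k : V)) (evec l))).
- by move=> l hl; rewrite H//; [rewrite admissible_e1 inner0l oppr0|left].
- by move=> l hl; rewrite H//; [rewrite admissible_e2n inner0l oppr0|right].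
move=> k hk; apply: k1_cases.
- by rewrite admissible_e1 inner0l H ?oppr0//; [left|lia].
- by rewrite admissible_e2n inner0l H ?oppr0//; [right|lia].
move=> l hl; case: hA => _ _ skew _.
by rewrite skew ?mem_k1// innerC.
Qed.

Lemma inner_Al X Y : inner (A *m X) Y = - inner X (A *m Y).
Proof. by rewrite inner_mulmxl tr_admissible mulNmx innerNr. Qed.

Lemma inner_A_e1 X : inner (A *m X) e1 = 0.
Proof. by rewrite inner_Al admissible_e1 inner0r oppr0. Qed.

Lemma inner_A_e2n X : inner (A *m X) e2n = 0.
Proof. by rewrite inner_Al admissible_e2n inner0r oppr0. Qed.

Lemma admissibleJ X : A *m (J *m X) = J *m (A *m X).
Proof.
rewrite !mulmxA; congr (_ *m X); apply: mulmx_evec_inj => k hk.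
rewrite -!mulmxA; move: k hk.
apply: (k1_cases (fun k => A *m (J *m (evec k : V)) = J *m (A *m evec k))).
- by rewrite Jmx_evec1// admissible_e1 admissible_e2n mulmx0.
- by rewrite Jmx_evec_last// admissible_e2n mulmxN admissible_e1 mulmx0 oppr0.
by move=> k hk; case: hA => _ comm _ _; apply: comm; exact: mem_k1.
Qed.

(** Since e^{23} = g(K ., .) and A is skew, A^* e^{23} = 0 says on k_1 that A and K commute. On e_1
    and e_{2n} both products vanish, and both images are orthogonal to these vectors. *)
Lemma admissibleK X : A *m (K *m X) = K *m (A *m X).
Proof.
rewrite !mulmxA; congr (_ *m X); apply: mulmx_evec_inj => k hk.
rewrite -!mulmxA; move: k hk.
apply: (k1_cases (fun k => A *m (K *m (evec k : V)) = K *m (A *m evec k))).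
- by rewrite Kmx_e1// admissible_e1 !mulmx0.
- by rewrite Kmx_e2n// admissible_e2n !mulmx0.
move=> k hk; apply: inner_evec_inj.
apply: (k1_cases (fun l => inner (A *m (K *m (evec k : V))) (evec l)
  = inner (K *m (A *m evec k)) (evec l))).
- by rewrite inner_A_e1 inner_K_e1.
- by rewrite inner_A_e2n inner_K_e2n.
move=> l hl; case: hA => _ _ _ /(_ _ _ (mem_k1 _ hk) (mem_k1 _ hl)).
by rewrite !e23_inner inner_Al; lra.
Qed.

Lemma muAcE c X Y : muAc A c X Y =
  inner X e2n *: (A *m Y) - inner Y e2n *: (A *m X)
  - (c * inner (K *m X) Y) *: e1.
Proof. by rewrite /muAc e23_inner. Qed.

Lemma inner_muAc_e2n c X Y : inner (muAc A c X Y) e2n = 0.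
Proof. by rewrite muAcE !inner_lin !inner_A_e2n inner_e1_e2n//; ring. Qed.

Lemma inner_muAc_e1 c X Y : inner (muAc A c X Y) e1 = - c * inner (K *m X) Y.
Proof.
rewrite muAcE !inner_lin !inner_A_e1 inner_evec; last by lia.
rewrite eqxx mulr1; ring.
Qed.

Lemma mulmx_muAc (B : 'M[R]_(2 * n)) c X Y : B *m muAc A c X Y =
  inner X e2n *: (B *m (A *m Y)) - inner Y e2n *: (B *m (A *m X))
  - (c * inner (K *m X) Y) *: (B *m e1).
Proof. by rewrite muAcE !mulmxBr -!scalemxAr. Qed.

Lemma muAc_bilin c : bilin (muAc A c).
Proof.
split=> U a X Y /=; apply/colP => k;
  by rewrite !muAcE !mulmxDr -!scalemxAr !inner_lin !col_lin; ring.
Qed.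

Lemma muAc_lie c : is_lie (muAc A c).
Proof.
split; first exact: muAc_bilin.
  move=> X; have KX0 : inner (K *m X) X = 0.
    by move: (inner_Kl X X); rewrite (innerC X); lra.
  by rewrite muAcE subrr sub0r KX0 mulr0 scale0r oppr0.
move=> X Y Z; rewrite !(muAcE _ _ (muAc _ _ _ _)) !inner_muAc_e2n !mulmx_muAc
  admissible_e1.
(* KA is symmetric, as a product of commuting skew maps, so the e_1 components cancel in the Jacobi
   sum. *)
have E U W : inner (K *m U) (A *m W) = inner (K *m W) (A *m U).
  by rewrite inner_Kl -admissibleK innerC inner_Al opprK.
rewrite !(muAcE _ Y Z) !(muAcE _ Z X) !(muAcE _ X Y) !inner_lin !inner_K_e1//.
rewrite (E Y X) (E Z X) (E Z Y).
by apply/colP => k; rewrite !col_lin; ring.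
Qed.

Lemma muAc_integrable c : integrable_J (muAc A c).
Proof.
move=> X Y; rewrite !mulmx_muAc !muAcE Jmx_evec1// !inner_J_e2n//
  !admissibleJ !JJ//.
rewrite !KmxJ// inner_JJ// (inner_Jl (K *m X)).
by apply/colP => k; rewrite !col_lin; ring.
Qed.

Definition muAc_bismut c : bracket R n :=
  fun X Y => (c * inner X e1) *: (K *m Y) + inner X e2n *: (A *m Y).

Lemma muAc_bismutP c : bismut (muAc A c) (muAc_bismut c).
Proof.
split.
- split=> U a X Y /=; apply/colP => k;
    by rewrite /muAc_bismut ?(mulmxDr, inner_lin) -?scalemxAr !col_lin; ring.
- move=> X Y Z; rewrite !inner_lin inner_Kl inner_Al; ring.
- by move=> X Y; rewrite /muAc_bismut admissibleJ KmxJ// mulmxDr -!scalemxAr.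
(* The torsion is the 3-form c e^1 /\ e^{23}, hence totally skew. *)
have E X Y Z : inner (torsion (muAc A c) (muAc_bismut c) X Y) Z =
   c * (inner X e1 * inner (K *m Y) Z - inner Y e1 * inner (K *m X) Z
        + inner Z e1 * inner (K *m X) Y).
  rewrite /torsion muAcE /muAc_bismut !inner_lin (innerC e1); ring.
have S X Y : inner (K *m X) Y = - inner (K *m Y) X by rewrite inner_Kl innerC.
move=> X Y Z; rewrite !E (S Y X) (S Z Y); split; ring.
Qed.

(** Every nabla_X lies in the span of the commuting maps A and K, so only - nabla_{[X, Y]} survives.
    As [X, Y] has no e_{2n} component and e_1 component - c e^{23}(X, Y), this is a multiple of
    K. *)
Lemma muAc_curvature c X Y Z :
  curvature (muAc A c) (muAc_bismut c) X Y Z =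
  (c ^+ 2 * inner (K *m X) Y) *: (K *m Z).
Proof.
rewrite /curvature /muAc_bismut inner_muAc_e2n inner_muAc_e1 !mulmxDr
  -!scalemxAr !admissibleK.
by apply/colP => k; rewrite !col_lin; ring.
Qed.

Lemma muAc_ricci c X Y :
  ricci_form (muAc A c) (muAc_bismut c) X Y = - c ^+ 2 * inner (K *m X) Y.
Proof.
rewrite /ricci_form.
under eq_bigr do rewrite muAc_curvature innerZl.
by rewrite -mulr_sumr trace_KJ//; field.
Qed.

Definition muAc_P c : 'M[R]_(2 * n) := (c ^+ 2 / 2) *: (K *m K).

Lemma muAc_P_mul c X : muAc_P c *m X = (c ^+ 2 / 2) *: (J *m (K *m X)).
Proof. by rewrite -scalemxAl -mulmxA KmxK. Qed.

(** Because K commutes with J, the form rho^B is already of type (1,1). Moreover J P = - (c^2 / 2)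
    K, which matches - c^2 e^{23} = 2 omega(P ., .). *)
Lemma muAc_isP c : is_Pmu (muAc A c) (muAc_P c).
Proof.
exists (muAc_bismut c); split; first exact: muAc_bismutP.
move=> X Y; rewrite /part11 !muAc_ricci /omega muAc_P_mul -scalemxAr JJ//
  !inner_lin.
by rewrite KmxJ// inner_JJ//; field.
Qed.

(** P commutes with A, kills e_1, and has image orthogonal to e_{2n}, so the A-terms cancel. What
    remains is e^{23} contracted with P in each slot. As c enters the bracket through - c e^{23}
    e_1, this is the equation c' = - c^3. *)
Lemma muAc_flow c X Y : - pi_act (muAc_P c) (muAc A c) X Y =
  (c ^+ 3 * inner (K *m X) Y) *: e1.
Proof.
(* J K = - pr, and K X already lies in the span of e_2 and e_3. *)
have KJK : inner (K *m X) (J *m (K *m Y)) = - inner (K *m X) Y.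
  by rewrite -KmxJ// -(innerC (K *m (J *m Y))) inner_Kl inner_Jl KmxK//
    opprK JJ// innerNr innerC.
rewrite /pi_act mulmx_muAc !muAc_P_mul !muAcE.
rewrite -!scalemxAr !inner_lin !inner_J_e2n// !inner_K_e1// Kmx_e1// mulmx0.
rewrite !admissibleJ !admissibleK !KmxJ// KmxK// JJ// innerNl KJK.
by apply/colP => k; rewrite !col_lin; field.
Qed.

End Admissible.

(** * Geometry of the limit bracket mu(A, 0) *)

Section Limit.
Context {R : realType} {n : nat}.
Hypothesis hn : (2 <= n)%N.
Local Notation V := 'cV[R]_(2 * n).
Local Notation J := (@Jmx R n).
Local Notation e2n := (evec (2 * n) : V).
Context {A : 'M[R]_(2 * n)}.
Hypothesis hA : admissible A.
Implicit Types (X Y Z : V).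

Lemma muA0E X Y :
  muAc A 0 X Y = inner X e2n *: (A *m Y) - inner Y e2n *: (A *m X).
Proof. by rewrite muAcE mul0r scale0r subr0. Qed.

Lemma muA0_kahler : kahler (muAc A 0).
Proof.
split; first exact: muAc_integrable.
(* J A is symmetric, as a product of commuting skew maps; this makes the terms of d omega cancel in
   pairs. *)
have S X Y : inner (J *m (A *m X)) Y = inner (J *m (A *m Y)) X.
  by rewrite -(admissibleJ hn hA) (inner_Al hn hA) inner_Jl opprK innerC.
move=> X Y Z; rewrite /d2 /omega !muA0E !mulmxBr -!scalemxAr !inner_lin.
rewrite (S Y X) (S Z X) (S Z Y); ring.
Qed.

(** The Levi-Civita connection is nabla_X = x_{2n} A. These operators commute, and brackets have no
    e_{2n} component, so the curvature vanishes. *)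
Lemma muA0_flat : flat (muAc A 0).
Proof.
exists (fun X Y => inner X e2n *: (A *m Y)); split; last first.
  move=> X Y Z; rewrite /curvature (inner_muAc_e2n hn hA) -!scalemxAr.
  by apply/colP => k; rewrite !col_lin; ring.
split.
- split=> U a X Y /=; apply/colP => k;
    by rewrite ?(mulmxDr, inner_lin) -?scalemxAr !col_lin; ring.
- move=> X Y Z; rewrite !inner_lin (inner_Al hn hA); ring.
by move=> X Y; rewrite /torsion muA0E; apply/colP => k; rewrite !col_lin; ring.
Qed.

Lemma muA0_almost_abelian : almost_abelian (muAc A 0).
Proof.
(* The abelian ideal is the orthogonal complement of e_{2n}, taken as the kernel of this functional
   so that rank-nullity gives its dimension. *)
pose f : {linear V -> 'M[R]_(1, 1)} := mulmx (e2n^T).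
have fE X : f X = (inner X e2n)%:M by rewrite innerC innerE -mx11_scalar.
have kerE X : (X \in lker (linfun f)) = (inner X e2n == 0).
  rewrite memv_ker lfunE fE; apply/eqP/eqP => [/matrixP/(_ 0 0)|->];
    last by rewrite raddf0.
  by rewrite !mxE eqxx.
exists (lker (linfun f)); split.
- by move=> X Y _; rewrite kerE (inner_muAc_e2n hn hA).
- by move=> X Y; rewrite !kerE => /eqP h /eqP h';
  rewrite muA0E h h' !scale0r subrr.
have dim1 : (\dim (limg (linfun f)) <= 1)%N
  by rewrite (leq_trans (dimvS (subvf _)))// dimvf.
have dim_neq0 : \dim (limg (linfun f)) != 0%N.
  rewrite dimv_eq0; apply/eqP => h.
  have : linfun f e2n \in limg (linfun f) by rewrite memv_img ?memvf.
  rewrite h memv0 lfunE fE inner_evec ?eqxx; last by lia.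
  by move=> /eqP/matrixP/(_ 0 0); rewrite !mxE eqxx => /eqP; rewrite oner_eq0.
have dim_img : \dim (limg (linfun f)) = 1%N by lia.
by have := limg_ker_dim (linfun f) fullv;
  rewrite capfv dimvf dim_img /dim /= muln1 addn1.
Qed.

End Limit.

(** * The Bismut connection of an integrable bracket *)

Section BismutFormula.
Context {R : realType} {n : nat}.
Hypothesis hn : (2 <= n)%N.
Local Notation V := 'cV[R]_(2 * n).
Local Notation J := (@Jmx R n).
Implicit Types (X Y Z : V) (mu nabla : bracket R n).

Definition bismut_torsion mu X Y Z : R :=
  d2 mu (@omega R n) (J *m X) (J *m Y) (J *m Z).

(* Koszul formula for a metric connection with totally skew torsion. *)
Definition bismut_form mu X Y Z : R :=
  2^-1 * (inner (mu X Y) Z - inner (mu Y Z) X + inner (mu Z X) Y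
          + bismut_torsion mu X Y Z).

Definition bismut_of mu : bracket R n :=
  fun X Y => \col_k bismut_form mu X Y (delta_mx k 0).

(** Since g and J are parallel, both the Nijenhuis tensor and d omega can be written in the torsion
    T alone. Both computations lead to T(JX, JY, Z) + T(JX, Y, JZ) + T(X, JY, JZ). *)
Lemma torsion_bismut mu nabla X Y Z : integrable_J mu -> bismut mu nabla ->
  inner (torsion mu nabla X Y) Z = bismut_torsion mu X Y Z.
Proof.
move=> intJ [_ metric par skew].
pose N X Y Z := inner (nabla X Y) Z.
pose T X Y Z := inner (torsion mu nabla X Y) Z.
have NJ U W S : N U W (J *m S) = - N U (J *m W) S
  by rewrite /N par inner_Jl opprK.
have Nskew U W S : N U W S = - N U S W.
  by move: (metric U W S); rewrite -/(N _ _ _) innerC -/(N _ _ _); lra.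
have muE U W S : inner (mu U W) S = N U W S - N W U S - T U W S.
  by rewrite /T /torsion !inner_lin /N; ring.
have Tsk1 U W S : T U W S = - T W U S by case: (skew U W S).
have Tsk2 U W S : T U W S = - T U S W by case: (skew U W S).
have NJl U W S : N U (J *m W) S = - N U W (J *m S) by rewrite NJ opprK.
have NN U W S : N U W (- S) = - N U W S by rewrite /N innerNr.
have NJs U W S : N U (J *m S) W = N U (J *m W) S by rewrite NJl Nskew opprK.
(* This is the vanishing of the Nijenhuis tensor, paired with Z. *)
have -> : inner (torsion mu nabla X Y) Z =
    T (J *m X) (J *m Y) Z + T (J *m X) Y (J *m Z) + T X (J *m Y) (J *m Z).
  have := congr1 (fun U => inner U Z) (intJ X Y).
  by rewrite -/(T X Y Z) /= !inner_lin !inner_Jl !muE !NJl !JJ// !NN; lra.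
rewrite /bismut_torsion /d2 /omega !inner_Jl !JJ// !inner_lin !muE.
rewrite (NJs (J *m X) Y Z) (NJs (J *m Y) X Z) (NJs (J *m Z) X Y).
rewrite (Tsk2 (J *m X) (J *m Z) Y) (Tsk2 (J *m Y) (J *m Z) X)
  (Tsk1 (J *m Y) X (J *m Z)).
ring.
Qed.

Lemma bismut_ofE mu X Y k : bismut_of mu X Y k 0 =
  bismut_form mu X Y (delta_mx k 0).
Proof. by rewrite mxE. Qed.

(** In the signed cyclic sum of g([X, Y], Z) = N(X, Y, Z) - N(Y, X, Z) - T(X, Y, Z), where N(X, Y,
    Z) = g(nabla_X Y, Z), metricity leaves 2 N(X, Y, Z) and skewness of T leaves - T(X, Y, Z). The
    torsion is already known from mu. *)
Lemma bismut_unique mu nabla : integrable_J mu -> bismut mu nabla ->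
  nabla = bismut_of mu.
Proof.
move=> intJ bis; have tor U W S := torsion_bismut _ _ U W S intJ bis.
case: bis => _ metric _ skew.
apply/funext => X; apply/funext => Y; apply/colP => k.
rewrite bismut_ofE -inner_delta /bismut_form -tor.
move: (delta_mx k 0) => Z.
pose T X Y Z := inner (torsion mu nabla X Y) Z.
have muE U W S : inner (mu U W) S =
    inner (nabla U W) S - inner (nabla W U) S - T U W S.
  by rewrite /T /torsion !inner_lin; ring.
have Nskew U W S : inner (nabla U W) S = - inner (nabla U S) W.
  by move: (metric U W S); rewrite (innerC W); lra.
have Tsk1 U W S : T U W S = - T W U S by case: (skew U W S).
have Tsk2 U W S : T U W S = - T U S W by case: (skew U W S).
rewrite -/(T X Y Z) !muE (Nskew Z Y X) (Nskew Y Z X) (Nskew X Z Y).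
rewrite (Tsk2 Y Z X) (Tsk1 Y X Z) (Tsk1 Z X Y) (Tsk2 X Z Y).
by field.
Qed.

(* Solving omega(P X, Y) = rho^{1,1}(X, Y) / 2 for P uses J^{-1} = -J. *)
Definition P_of mu : 'M[R]_(2 * n) :=
  - J *m \matrix_(i, j) (2^-1 * part11 (ricci_form mu (bismut_of mu))
    (delta_mx j 0) (delta_mx i 0)).

Lemma P_of_unique mu P : integrable_J mu -> is_Pmu mu P -> P = P_of mu.
Proof.
move=> intJ [nabla [/(bismut_unique _ _ intJ) -> hP]].
have -> : P = - J *m (J *m P) by rewrite mulNmx mulmxA JmxJ// mulNmx opprK mul1mx.
congr (_ *m _); apply/matrixP => i j.
rewrite [RHS]mxE hP /omega mulmxA inner_delta -colE [col _ _ _ _]mxE.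
by field.
Qed.

End BismutFormula.

(** * Local Lipschitz continuity of the flow vector field *)

Section Lipschitz.
Context {R : realType} {n : nat}.
Local Notation V := 'cV[R]_(2 * n).
Local Notation J := (@Jmx R n).
Local Notation idx := ('I_(2 * n) * 'I_(2 * n) * 'I_(2 * n))%type.
Implicit Types (X Y Z : V) (mu nu : bracket R n) (p : idx).

Lemma bilinDl mu X Y Z : bilin mu -> mu (X + Y) Z = mu X Z + mu Y Z.
Proof. by case=> /(_ Z 1 X Y); rewrite /= !scale1r. Qed.

Lemma bilinDr mu X Y Z : bilin mu -> mu X (Y + Z) = mu X Y + mu X Z.
Proof. by case=> _ /(_ X 1 Y Z); rewrite /= !scale1r. Qed.

Lemma bilin0l mu X : bilin mu -> mu 0 X = 0.
Proof. by move=> h; apply: (addIr (mu 0 X)); rewrite -bilinDl// !add0r. Qed.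

Lemma bilin0r mu X : bilin mu -> mu X 0 = 0.
Proof. by move=> h; apply: (addIr (mu X 0)); rewrite -bilinDr// !add0r. Qed.

Lemma bilinZl mu a X Y : bilin mu -> mu (a *: X) Y = a *: mu X Y.
Proof. by move=> h; case: (h) => /(_ Y a X 0) /=;
  rewrite (bilin0l mu Y h) !addr0. Qed.

Lemma bilinZr mu a X Y : bilin mu -> mu X (a *: Y) = a *: mu X Y.
Proof. by move=> h; case: (h) => _ /(_ X a Y 0) /=;
  rewrite (bilin0r mu X h) !addr0. Qed.

(** Structure constants: they serve as coordinates on the space of bilinear brackets. *)
Definition coef p mu : R := mu (delta_mx p.1.1 0) (delta_mx p.1.2 0) p.2 0.

Lemma col_sum_delta X : X = \sum_i X i 0 *: delta_mx i 0.
Proof.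
rewrite {1}(matrix_sum_delta X); apply: eq_bigr => i _.
by rewrite big_ord_recl big_ord0 addr0.
Qed.

Lemma bilin_coef mu X Y k : bilin mu ->
  mu X Y k 0 = \sum_i \sum_j X i 0 * (Y j 0 * coef (i, j, k) mu).
Proof.
move=> h; rewrite {1}(col_sum_delta X) {1}(col_sum_delta Y).
rewrite (big_morph (mu^~ _) (fun a b => bilinDl mu a b _ h) (bilin0l mu _ h))
  summxE.
apply: eq_bigr => i _; rewrite bilinZl// mxE.
rewrite (big_morph (mu _) (fun a b => bilinDr mu _ a b h) (bilin0r mu _ h))
  summxE mulr_sumr.
by apply: eq_bigr => j _; rewrite bilinZr// mxE.
Qed.

Lemma coef_inj mu nu : bilin mu -> bilin nu ->
  (forall p, coef p mu = coef p nu) -> mu = nu.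
Proof.
move=> hmu hnu h; apply/funext => X; apply/funext => Y; apply/colP => k.
rewrite !bilin_coef//; apply: eq_bigr => i _; apply: eq_bigr => j _.
by rewrite h.
Qed.

Definition bounded_bracket M mu := bilin mu /\ forall p, `|coef p mu| <= M.

Definition bracket_dist mu nu : R := \sum_p `|coef p mu - coef p nu|.

Lemma bracket_dist_ge0 mu nu : 0 <= bracket_dist mu nu.
Proof. exact: sumr_ge0. Qed.

(* Boundedness and Lipschitz continuity on bounded sets; the two are bundled so
   that the class is closed under products. *)
Definition loc_lip (F : bracket R n -> R) := forall M, exists2 C, 0 <= C &
  forall mu nu, bounded_bracket M mu -> bounded_bracket M nu ->
    `|F mu| <= C /\ `|F mu - F nu| <= C * bracket_dist mu nu.

(** Agreement on bilinear brackets suffices because [bounded_bracket] includes bilinearity. This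
    permits expanding mu X Y in structure constants. *)
Lemma loc_lip_ext F G : (forall mu, bilin mu -> F mu = G mu) -> loc_lip F ->
  loc_lip G.
Proof.
move=> FG lF M; have [C C0 hC] := lF M; exists C => // mu nu hmu hnu.
by have [] := hC _ _ hmu hnu; case: hmu => hmu _; case: hnu => hnu _; rewrite !FG.
Qed.

Lemma loc_lip_cst a : loc_lip (fun=> a).
Proof.
move=> M; exists `|a| => // mu nu _ _; split=> //.
by rewrite subrr normr0 mulr_ge0// bracket_dist_ge0.
Qed.

Lemma loc_lip_coef p : loc_lip (coef p).
Proof.
(* The constant must be nonnegative whatever the sign of M, bound the coefficient, and be at least 1
   for the Lipschitz estimate. *)
move=> M; exists (`|M| + 1); first by rewrite addr_ge0.
move=> mu nu [_ hmu] _; split.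
  by rewrite (le_trans (hmu p))// (le_trans (ler_norm _))// lerDl.
apply: (@le_trans _ _ (bracket_dist mu nu)).
  by rewrite /bracket_dist (bigD1 p)//= lerDl sumr_ge0.
by rewrite ler_peMl ?bracket_dist_ge0// lerDr.
Qed.

Lemma loc_lipD F G : loc_lip F -> loc_lip G -> loc_lip (fun mu => F mu + G mu).
Proof.
move=> lF lG M; have [C C0 hC] := lF M; have [D D0 hD] := lG M.
exists (C + D); first exact: addr_ge0.
move=> mu nu hmu hnu; have [F1 F2] := hC _ _ hmu hnu;
  have [G1 G2] := hD _ _ hmu hnu.
split; first by rewrite (le_trans (ler_normD _ _))// lerD.
rewrite opprD addrACA mulrDl (le_trans (ler_normD _ _))//; exact: lerD.
Qed.

Lemma loc_lipM F G : loc_lip F -> loc_lip G -> loc_lip (fun mu => F mu * G mu).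
Proof.
move=> lF lG M; have [C C0 hC] := lF M; have [D D0 hD] := lG M.
exists (C * D + D * C); first by rewrite addr_ge0// mulr_ge0.
move=> mu nu hmu hnu; have [F1 F2] := hC _ _ hmu hnu;
  have [G1 G2] := hD _ _ hmu hnu.
(* The roles are swapped to bound G at nu, as the product splitting below requires. *)
have [G3 _] := hD _ _ hnu hmu.
split; first by rewrite normrM (le_trans (ler_pM _ _ F1 G1))// lerDl mulr_ge0.
have -> : F mu * G mu - F nu * G nu =
    F mu * (G mu - G nu) + G nu * (F mu - F nu) by ring.
rewrite (le_trans (ler_normD _ _))// !normrM mulrDl -!mulrA.
by apply: lerD; apply: ler_pM.
Qed.

Lemma loc_lipN F : loc_lip F -> loc_lip (fun mu => - F mu).
Proof.
move=> lF; apply: (loc_lip_ext (fun mu => -1 * F mu)).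
  by move=> mu _; rewrite mulN1r.
exact: (loc_lipM _ _ (loc_lip_cst _) lF).
Qed.

Lemma loc_lipB F G : loc_lip F -> loc_lip G -> loc_lip (fun mu => F mu - G mu).
Proof. by move=> lF lG; apply: loc_lipD => //; apply: loc_lipN. Qed.

Lemma loc_lip_sum (I : Type) (r : seq I) (F : I -> bracket R n -> R) :
  (forall i, loc_lip (F i)) -> loc_lip (fun mu => \sum_(i <- r) F i mu).
Proof.
move=> lF; elim: r => [|i r IH].
  apply: (loc_lip_ext (fun=> 0)); last exact: loc_lip_cst.
  by move=> mu _; rewrite big_nil.
apply: (loc_lip_ext (fun mu => F i mu + \sum_(i <- r) F i mu)).
  by move=> mu _; rewrite big_cons.
exact: loc_lipD.
Qed.

Definition loc_lip_mx a b (G : bracket R n -> 'M[R]_(a, b)) :=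
  forall i j, loc_lip (fun mu => G mu i j).

Lemma loc_lip_mx_cst a b (B : 'M[R]_(a, b)) : loc_lip_mx _ _ (fun=> B).
Proof. by move=> i j; apply: loc_lip_cst. Qed.

Lemma loc_lip_mxB a b G H : loc_lip_mx a b G -> loc_lip_mx a b H ->
  loc_lip_mx a b (fun mu => G mu - H mu).
Proof.
move=> lG lH i j; apply: (loc_lip_ext (fun mu => G mu i j - H mu i j)).
  by move=> mu _; rewrite !mxE.
exact: loc_lipB.
Qed.

Lemma loc_lip_mulmx a b c G H : loc_lip_mx a b G -> loc_lip_mx b c H ->
  loc_lip_mx a c (fun mu => G mu *m H mu).
Proof.
move=> lG lH i j; apply: (loc_lip_ext (fun mu => \sum_k G mu i k * H mu k j)).
  by move=> mu _; rewrite mxE.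
by apply: loc_lip_sum => k; apply: loc_lipM.
Qed.

Local Notation loc_lip_vec := (loc_lip_mx (2 * n) 1).

(** The bracket and its arguments vary together; in structure constants the value is a finite sum of
    products, which the class is closed under. *)
Lemma loc_lip_bracket G H : loc_lip_vec G -> loc_lip_vec H ->
  loc_lip_vec (fun mu => mu (G mu) (H mu)).
Proof.
move=> lG lH k j; rewrite (ord1 j).
apply: (loc_lip_ext (fun mu =>
  \sum_i \sum_j G mu i 0 * (H mu j 0 * coef (i, j, k) mu))).
  by move=> mu hmu; rewrite bilin_coef.
apply: loc_lip_sum => i; apply: loc_lip_sum => l.
by apply: loc_lipM => //; apply: loc_lipM => //; apply: loc_lip_coef.
Qed.

Lemma loc_lip_inner G H : loc_lip_vec G -> loc_lip_vec H ->
  loc_lip (fun mu => inner (G mu) (H mu)).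
Proof. by move=> lG lH; apply: loc_lip_sum => i; apply: loc_lipM. Qed.

Lemma loc_lip_J G : loc_lip_vec G -> loc_lip_vec (fun mu => J *m G mu).
Proof. by move=> lG; apply: loc_lip_mulmx => //; apply: loc_lip_mx_cst. Qed.

Lemma loc_lip_omega G H : loc_lip_vec G -> loc_lip_vec H ->
  loc_lip (fun mu => omega (G mu) (H mu)).
Proof. by move=> lG lH; apply: loc_lip_inner => //; apply: loc_lip_J. Qed.

Lemma loc_lip_bismut G H : loc_lip_vec G -> loc_lip_vec H ->
  loc_lip_vec (fun mu => bismut_of mu (G mu) (H mu)).
Proof.
move=> lG lH k j; rewrite (ord1 j).
have lZ := loc_lip_mx_cst _ _ (delta_mx k 0 : V); set Z := delta_mx k 0 in lZ.
have JG := loc_lip_J _ lG; have JH := loc_lip_J _ lH; have JZ := loc_lip_J _ lZ.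
apply: (loc_lip_ext (fun mu => bismut_form mu (G mu) (H mu) Z)).
  by move=> mu _; rewrite bismut_ofE.
apply: loc_lipM; first exact: loc_lip_cst.
apply: loc_lipD; last first.
  apply: loc_lipB; last by apply: loc_lip_omega => //; apply: loc_lip_bracket.
  apply: loc_lipD; last by apply: loc_lip_omega => //; apply: loc_lip_bracket.
  by apply: loc_lipN; apply: loc_lip_omega => //; apply: loc_lip_bracket.
apply: loc_lipD; last by apply: loc_lip_inner => //; apply: loc_lip_bracket.
by apply: loc_lipB; apply: loc_lip_inner => //; apply: loc_lip_bracket.
Qed.

Lemma loc_lip_ricci X Y :
  loc_lip (fun mu => ricci_form mu (bismut_of mu) X Y).
Proof.
apply: loc_lipM; first exact: loc_lip_cst.
apply: loc_lip_sum => l; apply: loc_lip_inner; last exact: loc_lip_mx_cst.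
have cst := fun U : V => loc_lip_mx_cst _ _ U.
apply: loc_lip_mxB; first apply: loc_lip_mxB.
- by do 2! [apply: loc_lip_bismut => //].
- by do 2! [apply: loc_lip_bismut => //].
by apply: loc_lip_bismut => //; apply: loc_lip_bracket.
Qed.

Lemma loc_lip_P_of : loc_lip_mx _ _ (@P_of R n).
Proof.
apply: loc_lip_mulmx; first exact: loc_lip_mx_cst.
move=> i j.
apply: (loc_lip_ext (fun mu => 2^-1 * part11 (ricci_form mu (bismut_of mu))
  (delta_mx j 0) (delta_mx i 0))).
  by move=> mu _; rewrite mxE.
apply: loc_lipM; first exact: loc_lip_cst.
apply: loc_lipM; first exact: loc_lip_cst.
by apply: loc_lipD; apply: loc_lip_ricci.
Qed.

Lemma loc_lip_flow p : loc_lip (fun mu => coef p (pi_act (P_of mu) mu)).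
Proof.
have cst := fun U : V => loc_lip_mx_cst _ _ U.
have lP := loc_lip_P_of.
have lPX X : loc_lip_vec (fun mu => P_of mu *m X) by apply: loc_lip_mulmx.
suff h : loc_lip_vec (fun mu => pi_act (P_of mu) mu (delta_mx p.1.1 0)
  (delta_mx p.1.2 0)) by exact: h.
apply: loc_lip_mxB; first apply: loc_lip_mxB.
- by apply: loc_lip_mulmx => //; apply: loc_lip_bracket.
- exact: loc_lip_bracket.
exact: loc_lip_bracket.
Qed.

End Lipschitz.

(** * Uniqueness of the bracket flow *)

Section Calculus.
Context {R : realType}.
Implicit Types (f df : R -> R) (a b C t : R).

Lemma is_derive_bigsum (I : Type) (r : seq I) (f df : I -> R -> R) t :
  (forall i, is_derive t (1 : R) (f i) (df i t)) ->
  is_derive t (1 : R) (fun s => \sum_(i <- r) f i s) (\sum_(i <- r) df i t).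
Proof.
move=> h; elim: r => [|i r IH].
  rewrite big_nil (_ : (fun _ => _) = cst 0); last by apply/funext => s;
    rewrite big_nil.
  exact: is_derive_cst.
rewrite big_cons (_ : (fun _ => _) = f i + (fun s => \sum_(i <- r) f i s)).
  exact: is_deriveD.
by apply/funext => s; rewrite big_cons.
Qed.

Lemma derive_within_continuous f df a b :
  (forall t, a <= t <= b -> is_derive t (1 : R) f (df t)) ->
  {within `[a, b], continuous f}.
Proof.
move=> h; apply: derivable_within_continuous => t; rewrite in_itv => /h H.
exact: ex_derive.
Qed.

(** The extreme value theorem for |f|. It bounds solutions on compact time intervals, both to fix a
    Lipschitz constant and to exclude passing the blow-up time. *)
Lemma derive_bounded f df a b :
  (forall t, a <= t <= b -> is_derive t (1 : R) f (df t)) ->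
  exists M, forall t, a <= t <= b -> `|f t| <= M.
Proof.
move=> h; have [ab|ba] := leP a b; last first.
  by exists 0 => t /andP[at_ tb]; move: (le_trans at_ tb); rewrite leNgt ba.
have fc : {within `[a, b], continuous (fun t => `|f t|)}.
  move=> t; apply: (continuous_comp _ (@norm_continuous _ R _)).
  exact: (derive_within_continuous _ _ _ _ h).
have [c _ hc] := EVT_max ab fc; exists `|f c| => t tab; apply: hc.
by rewrite in_itv.
Qed.

(** With the integrating factor exp(- C t), the product f(t) exp(- C t) is nonincreasing. *)
Lemma gronwall_forward f df a b C : a <= b ->
  (forall t, a <= t <= b -> is_derive t (1 : R) f (df t)) ->
  (forall t, a <= t <= b -> df t <= C * f t) -> f a <= 0 -> f b <= 0.
Proof.
move=> ab hf hC fa.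
pose g t := f t * expR (- C * t).
have hg t : a <= t <= b ->
    is_derive t (1 : R) g ((df t - C * f t) * expR (- C * t)).
  move=> tab; have hft := hf t tab.
  have hl : is_derive t (1 : R) ( *%R (- C)) (- C).
    have := is_deriveZ (- C) (is_derive_id t (1 : R)).
    by rewrite scaler1.
  have he := is_derive1_comp (is_derive_expR (- C * t)) hl.
  apply: is_derive_eq (is_deriveM hft he) _.
  by rewrite /GRing.scale /=; ring.
have gab : g b <= g a.
  apply: (@ler0_derive1_le_cc R g a b); rewrite ?in_itv /= ?lexx ?ab//.
  - move=> t; rewrite in_itv /= => /andP[at_ tb].
    by have [] := hg t; rewrite ?ltW.
  - move=> t; rewrite in_itv /= => /andP[at_ tb].
    have tab : a <= t <= b by rewrite !ltW.
    have h := hg t tab; rewrite derive1E derive_val.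
    by rewrite pmulr_lle0 ?expR_gt0// subr_le0 hC.
  exact: derive_within_continuous _ _ _ _ hg.
rewrite -(pmulr_lle0 _ (expR_gt0 (- C * b))) (le_trans gab)//.
by rewrite pmulr_lle0 ?expR_gt0.
Qed.

Lemma gronwall_zero f df a b C : a <= 0 <= b ->
  (forall t, a <= t <= b -> is_derive t (1 : R) f (df t)) ->
  (forall t, a <= t <= b -> `|df t| <= C * f t) -> f 0 = 0 ->
  forall t, a <= t <= b -> f t <= 0.
Proof.
move=> /andP[a0 b0] hf hC f0 t /andP[at_ tb].
have [t0|t0] := leP 0 t.
  apply: (gronwall_forward f df 0 t C) => //; last by rewrite f0.
    by move=> s /andP[s0 st]; apply: hf;
      rewrite (le_trans a0 s0) (le_trans st tb).
  move=> s /andP[s0 st]; apply: le_trans (ler_norm _) _.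
  by apply: hC; rewrite (le_trans a0 s0) (le_trans st tb).
(* Negative times are handled by time reversal; the bound on |df| is insensitive to the sign
   change. *)
rewrite -[t]opprK; pose g s := f (- s).
have ok s : 0 <= s <= - t -> a <= - s <= b.
  move=> /andP[s0 st]; rewrite (le_trans at_) 1?lerNr//=.
  by rewrite (le_trans _ b0)// oppr_le0.
apply: (gronwall_forward g (fun s => - df (- s)) 0 (- t) C).
- by rewrite oppr_ge0 ltW.
- move=> s /ok hs; have hfs := hf _ hs.
  have hN : is_derive s (1 : R) (@GRing.opp R) (- 1) by exact: is_deriveN.
  apply: is_derive_eq (is_derive1_comp hfs hN) _.
  by rewrite mulrN1.
- by move=> s /ok hs; rewrite (le_trans (ler_norm _))// normrN hC.
by rewrite /g oppr0 f0.
Qed.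

End Calculus.

Section Uniqueness.
Context {R : realType} {n : nat}.
Hypothesis hn : (2 <= n)%N.
Local Notation V := 'cV[R]_(2 * n).
Implicit Types (X Y Z : V) (mu : bracket R n) (nu : R -> bracket R n) (D : set R).

Lemma is_derive_entry (F : R -> V) (t : R) (d : V) k :
  is_derive (t : R^o) (1 : R^o) (F : R^o -> V) d ->
  is_derive t (1 : R) (fun s => F s k 0) (d k 0).
Proof.
move=> [Fd <-]; split; first by move/derivable_mxP : Fd; apply.
by rewrite derive_mx// mxE.
Qed.

(** Since P is determined by the bracket, the structure constants of any solution obey one closed
    system of ordinary differential equations. *)
Lemma bracket_flow_coef mu0 D nu t p : bracket_flow mu0 D nu -> D t ->
  is_derive t (1 : R) (fun s => coef p (nu s))
    (- coef p (pi_act (P_of (nu t)) (nu t))).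
Proof.
move=> [_ _ _ _ flow] /flow[_ intJ [P hP]].
rewrite (P_of_unique hn _ _ intJ hP) => h.
apply: is_derive_eq (is_derive_entry _ _ _ p.2 (h _ _)) _.
by rewrite mxE.
Qed.

Lemma bracket_flow_unique mu0 D D' nu nu' t :
  bracket_flow mu0 D nu -> bracket_flow mu0 D' nu' -> D t -> D' t -> nu t = nu' t.
Proof.
move=> flow flow' Dt D't.
have [_ iD D0 nu0 lie] := flow; have [_ iD' D'0 nu'0 lie'] := flow'.
(* The compact interval between 0 and t, for either sign of t; it lies in both domains because they
   are intervals. *)
pose a := Num.min 0 t; pose b := Num.max 0 t.
have ab0 : a <= 0 <= b by rewrite ge_min le_max lexx.
have abt : a <= t <= b by rewrite ge_min le_max lexx !orbT.
have inD s : a <= s <= b -> D s.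
  by rewrite /a /b; case: (leP 0 t) => _; exact: iD.
have inD' s : a <= s <= b -> D' s.
  by rewrite /a /b; case: (leP 0 t) => _; exact: iD'.
have bil s : a <= s <= b -> bilin (nu s) by move=> /inD/lie[[]].
have bil' s : a <= s <= b -> bilin (nu' s) by move=> /inD'/lie'[[]].
have dcoef p s : a <= s <= b -> is_derive s (1 : R) (fun s => coef p (nu s)) _ :=
  fun hs => bracket_flow_coef _ _ _ _ p flow (inD s hs).
have dcoef' p s : a <= s <= b ->
    is_derive s (1 : R) (fun s => coef p (nu' s)) _ :=
  fun hs => bracket_flow_coef _ _ _ _ p flow' (inD' s hs).
have /choice[M hM] p := derive_bounded _ _ _ _ (dcoef p).
have /choice[M' hM'] p := derive_bounded _ _ _ _ (dcoef' p).
(* A single bound for all structure constants of both solutions, so that one Lipschitz constant per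
   coefficient applies throughout. *)
pose B := \sum_p (`|M p| + `|M' p|).
have MB p : `|M p| + `|M' p| <= B.
  by rewrite /B (bigD1 p)//= lerDl sumr_ge0// => q _; rewrite addr_ge0.
have bnd s : a <= s <= b -> bounded_bracket B (nu s).
  move=> hs; split; first exact: bil.
  move=> p; rewrite (le_trans (hM p s hs))// (le_trans (ler_norm _))//.
  by rewrite (le_trans _ (MB p))// lerDl.
have bnd' s : a <= s <= b -> bounded_bracket B (nu' s).
  move=> hs; split; first exact: bil'.
  move=> p; rewrite (le_trans (hM' p s hs))// (le_trans (ler_norm _))//.
  by rewrite (le_trans _ (MB p))// lerDr.
have /choice[C hC] p : exists C, 0 <= C /\ forall s, a <= s <= b ->
    `|coef p (pi_act (P_of (nu s)) (nu s))
      - coef p (pi_act (P_of (nu' s)) (nu' s))|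
      <= C * bracket_dist (nu s) (nu' s).
  have [C C0 h] := loc_lip_flow p B.
  by exists C; split=> // s hs; have [] := h _ _ (bnd s hs) (bnd' s hs).
pose d p s := coef p (nu s) - coef p (nu' s).
pose dd p s := - coef p (pi_act (P_of (nu s)) (nu s))
               + coef p (pi_act (P_of (nu' s)) (nu' s)).
(* The squared Euclidean distance replaces [bracket_dist] because it is differentiable. *)
pose f s := \sum_p d p s ^+ 2.
have df s : a <= s <= b -> is_derive s (1 : R) f (\sum_p 2 * d p s * dd p s).
  move=> hs; apply: (is_derive_bigsum _ _ (fun p s => d p s ^+ 2)
    (fun p s => 2 * d p s * dd p s)) => p.
  have hd : is_derive s (1 : R) (d p) (dd p s).
    by apply: is_derive_eq (is_deriveB (dcoef p s hs) (dcoef' p s hs)) _;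
      rewrite /dd opprK.
  by apply: is_derive_eq (is_deriveX 2 hd) _; rewrite expr1.
have d2f p s : d p s ^+ 2 <= f s.
  by rewrite /f (bigD1 p)//= lerDl sumr_ge0// => q _; rewrite sqr_ge0.
have ddf p q s : `|d p s| * `|d q s| <= f s.
  have := d2f p s; have := d2f q s; rewrite -(real_normK (num_real (d p s))).
  rewrite -(real_normK (num_real (d q s))).
  move: `|d p s| `|d q s| (f s) => x y z; nra.
have f0 : f 0 = 0.
  by rewrite /f big1// => p _; rewrite /d nu0 nu'0 subrr expr0n.
(* [bracket_dist] has N terms, so |d_p| times it is at most N f by [ddf]. *)
pose N : R := #|{: 'I_(2 * n) * 'I_(2 * n) * 'I_(2 * n)}|%:R.
have hdf s : a <= s <= b -> `|\sum_p 2 * d p s * dd p s|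
    <= (\sum_p 2 * C p * N) * f s.
  move=> hs; rewrite mulr_suml (le_trans (ler_norm_sum _ _ _))//.
  apply: ler_sum => p _; have [C0 hCp] := hC p.
  rewrite !normrM (ger0_norm (_ : 0 <= 2))// -!mulrA ler_pM2l//.
  have -> : `|dd p s| = `|coef p (pi_act (P_of (nu s)) (nu s))
                      - coef p (pi_act (P_of (nu' s)) (nu' s))|.
    by rewrite /dd -normrN opprD opprK.
  apply: le_trans (ler_wpM2l _ (hCp s hs)) _ => //.
  rewrite mulrCA; apply: ler_wpM2l => //.
  rewrite /bracket_dist mulr_sumr mulr_natl -sumr_const.
  by apply: ler_sum => q _; exact: ddf.
have ft := gronwall_zero _ _ _ _ _ ab0 df hdf f0 t abt.
apply: coef_inj; [exact: bil|exact: bil'|move=> p].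
have := le_trans (d2f p t) ft.
by rewrite real_exprn_even_le0 ?num_real//= subr_eq0 => /eqP.
Qed.

End Uniqueness.

(** * The explicit solution *)

Definition flow_coef {R : realType} (c0 t : R) : R :=
  c0 / Num.sqrt (1 + 2 * c0 ^+ 2 * t).

Section FlowCoefficient.
Context {R : realType} {c0 : R}.
Hypothesis hc0 : c0 != 0.
Local Notation c := (flow_coef c0).
Local Notation D := [set t : R | - (2 * c0 ^+ 2)^-1 < t].

Let c2_gt0 : 0 < 2 * c0 ^+ 2.
Proof. by rewrite mulr_gt0// exprn_even_gt0. Qed.

Lemma flow_domain_gt0 t : D t -> 0 < 1 + 2 * c0 ^+ 2 * t.
Proof.
rewrite /= -(ltr_pM2l c2_gt0) mulrN divff ?gt_eqF//; lra.
Qed.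

Lemma flow_coef_sqr t : D t -> c t ^+ 2 = c0 ^+ 2 / (1 + 2 * c0 ^+ 2 * t).
Proof. by move=> /flow_domain_gt0 h; rewrite /flow_coef expr_div_n sqr_sqrtr//
  ltW. Qed.

Lemma flow_coef0 : c 0 = c0.
Proof. by rewrite /flow_coef mulr0 addr0 sqrtr1 divr1. Qed.

Lemma is_derive_flow_coef t : D t -> is_derive t (1 : R) c (- c t ^+ 3).
Proof.
pose u s := 1 + 2 * c0 ^+ 2 * s.
move=> /flow_domain_gt0 u0; have s0 : Num.sqrt (u t) != 0
  by rewrite gt_eqF// sqrtr_gt0.
have du : is_derive t (1 : R) u (2 * c0 ^+ 2).
  have := is_deriveD (is_derive_cst (1 : R) t (1 : R))
    (is_deriveZ (2 * c0 ^+ 2) (is_derive_id t (1 : R))).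
  by rewrite add0r scaler1.
have ds := @is_derive1_comp R Num.sqrt u t _ _ (is_derive1_sqrt u0) du.
have dc : is_derive t (1 : R) c _ :=
  is_deriveZ c0 (@is_deriveV _ (Num.sqrt \o u) _ _ _ s0 ds).
apply: is_derive_eq dc _.
rewrite /GRing.scale /= /flow_coef -/(u t).
by field.
Qed.

Lemma cvg_flow_coef : c t @[t --> +oo] --> (0 : R).
Proof.
apply/cvgr0Pnorm_lt => e e0.
near=> t.
have tpos : 0 < t by near: t; exact: nbhs_pinfty_gt.
(* For t > 0, c(t)^2 < 1 / (2 t), which is below e^2 beyond this threshold. *)
have te : (2 * e ^+ 2)^-1 < t by near: t; apply: nbhs_pinfty_gt; rewrite num_real.
have Dt : D t by apply: lt_trans tpos; rewrite oppr_lt0 invr_gt0; exact: c2_gt0.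
rewrite -(@ltr_pXn2r _ 2)// ?nnegrE// ?(ltW e0)// real_normK ?num_real//.
rewrite flow_coef_sqr// ltr_pdivrMr ?flow_domain_gt0//.
have : 1 < 2 * e ^+ 2 * t.
  by rewrite -(ltr_pM2l (_ : 0 < 2 * e ^+ 2)) ?mulr_gt0 ?exprn_gt0//
    divff ?gt_eqF ?mulr_gt0 ?exprn_gt0// in te.
have : 0 < c0 ^+ 2 by rewrite exprn_even_gt0.
have : 0 < e ^+ 2 by rewrite exprn_gt0.
move: (e ^+ 2) (c0 ^+ 2) => x y; nra.
Unshelve. all: by end_near. Qed.

Lemma flow_coef_unbounded M : exists2 s, D s /\ s <= 0 & M < `|c s|.
Proof.
pose T := (2 * c0 ^+ 2)^-1; have T0 : 0 < T by rewrite invr_gt0.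
pose B := M ^+ 2 + 1; have B0 : 0 < B by rewrite ltr_wpDl// sqr_ge0.
(* At time - T + d one has c^2 = 1 / (2 d). The bound d <= T keeps this time nonpositive, and d <= 1
   / (2 B) gives c^2 >= B > M^2. *)
pose d := Num.min T (2 * B)^-1.
have d0 : 0 < d by rewrite lt_min T0 invr_gt0 mulr_gt0.
have Ds : D (- T + d) by rewrite /= ltrDl.
exists (- T + d).
  by split => //; rewrite addrC subr_le0 ge_min lexx.
have : M ^+ 2 < `|c (- T + d)| ^+ 2.
  rewrite real_normK ?num_real// flow_coef_sqr//.
  have -> : c0 ^+ 2 / (1 + 2 * c0 ^+ 2 * (- T + d)) = (2 * d)^-1.
    have -> : 1 + 2 * c0 ^+ 2 * (- T + d) = 2 * c0 ^+ 2 * d by rewrite /T; field.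
    by field; rewrite hc0 gt_eqF.
  have : B <= (2 * d)^-1; last by rewrite /B; lra.
  have dB : d * (2 * B) <= 1.
    by rewrite -ler_pdivlMr ?mulr_gt0// div1r ge_min lexx orbT.
  by rewrite -div1r ler_pdivlMr ?mulr_gt0//; lra.
have [M0|M0 _] := leP 0 M; last exact: lt_le_trans M0 (normr_ge0 _).
by rewrite ltr_pXn2r// nnegrE.
Qed.

End FlowCoefficient.

(** * The explicit flow line, its maximality and its limit *)

Section Flow.
Context {R : realType} {n : nat} {A : 'M[R]_(2 * n)} {c0 : R}.
Hypothesis hn : (2 <= n)%N.
Hypothesis hA : admissible A.
Hypothesis hc0 : c0 != 0.
Local Notation V := 'cV[R]_(2 * n).
Local Notation c := (flow_coef c0).
Local Notation D := [set t : R | - (2 * c0 ^+ 2)^-1 < t].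

Lemma is_derive_col (F : R -> V) (t : R) (d : V) :
  (forall k, is_derive t (1 : R) (fun s => F s k 0) (d k 0)) ->
  is_derive (t : R^o) (1 : R^o) (F : R^o -> V) d.
Proof.
move=> h; have Fd : derivable (F : R^o -> V) (t : R^o) (1 : R^o).
  by apply/derivable_mxP => i j; rewrite (ord1 j); apply: ex_derive.
split => //; rewrite derive_mx//; apply/colP => k; rewrite mxE.
by have [] := h k.
Qed.

Lemma muAc_bracket_flow : bracket_flow (muAc A c0) D (fun t => muAc A (c t)).
Proof.
have c2_gt0 : 0 < 2 * c0 ^+ 2 by rewrite mulr_gt0// exprn_even_gt0.
split.
- exact: open_gt.
- by move=> x y Dx _ z /andP[xz _]; apply: lt_le_trans Dx xz.
- by rewrite /= oppr_lt0 invr_gt0.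
- by rewrite flow_coef0.
move=> t Dt; split; [exact: muAc_lie|exact: muAc_integrable|].
exists (muAc_P (c t)); first exact: muAc_isP.
move=> X Y; rewrite muAc_flow//; apply: is_derive_col => k.
(* v is the part of the bracket independent of c; the rest is linear in c. *)
pose v : V :=
  inner X (evec (2 * n)) *: (A *m Y) - inner Y (evec (2 * n)) *: (A *m X).
pose e := inner (Kmx *m X) Y * (evec 1 : V) k 0.
have -> : (fun s => muAc A (c s) X Y k 0) = cst (v k 0) - (e \*: c).
  apply/funext => s; rewrite muAcE [LHS]colDE -/v colNE colZE.
  by rewrite [RHS](_ : _ = v k 0 - e * c s)// /e; ring.
apply: is_derive_eq (is_deriveB (is_derive_cst (v k 0) t (1 : R))
  (is_deriveZ e (is_derive_flow_coef hc0 t Dt))) _.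
rewrite colZE [e *: _](_ : _ = e * (- c t ^+ 3))// /e; ring.
Qed.

(** Uniqueness forces agreement on the common domain. If D' reached - 1 / (2 c_0^2) or earlier, it
    would contain the compact interval from there to 0, on which nu' is bounded while c is not. *)
Lemma muAc_flow_maximal D' nu' : bracket_flow (muAc A c0) D' nu' ->
  D' `<=` D /\ forall t, D' t -> nu' t = muAc A (c t).
Proof.
move=> flow'; have [_ iD' D'0 _ _] := flow'.
have uniq t : D t -> D' t -> nu' t = muAc A (c t).
  by move=> Dt D't; rewrite (bracket_flow_unique hn _ _ _ _ _ _
    muAc_bracket_flow flow' Dt D't).
suff sub : D' `<=` D by split=> // t D't; apply: uniq => //; apply: sub.
move=> t D't; rewrite /= ltNge; apply/negP => tT.
have [i1 _ i1E] : exists2 i : 'I_(2 * n), 1%N = i.+1 & evec 1 = delta_mx i 0 :> V.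
  by apply: evecP; lia.
have [i2 _ i2E] : exists2 i : 'I_(2 * n), 2%N = i.+1 & evec 2 = delta_mx i 0 :> V.
  by apply: evecP; lia.
have [i3 _ i3E] : exists2 i : 'I_(2 * n), 3%N = i.+1 & evec 3 = delta_mx i 0 :> V.
  by apply: evecP; lia.
(* This selects the e_1 component of [e_2, e_3], which is - c. *)
pose p := (i2, i3, i1).
have coefp a : coef p (muAc A a) = - a.
  rewrite /coef /= -i2E -i3E -inner_delta -i1E inner_muAc_e1// Kmx_mul !inner_lin.
  by rewrite !inner_evec; [rewrite /=; ring|lia..].
have inD' s : - (2 * c0 ^+ 2)^-1 <= s <= 0 -> D' s.
  by move=> /andP[Ts s0]; apply: (iD' _ _ D't D'0); rewrite (le_trans tT Ts).
have [M hM] := derive_bounded _ _ _ _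
  (fun s hs => bracket_flow_coef hn _ _ _ s p flow' (inD' s hs)).
have [s [Ds s0] Ms] := flow_coef_unbounded hc0 M.
have hs : - (2 * c0 ^+ 2)^-1 <= s <= 0 by rewrite (ltW Ds).
have := hM s hs; rewrite (uniq s Ds (inD' s hs)) coefp normrN.
by rewrite leNgt Ms.
Qed.

Lemma muAc_cvg X Y : muAc A (c t) X Y @[t --> +oo] --> muAc A 0 X Y.
Proof.
(* mu(A, a) is affine in a, so convergence of c to 0 carries over to the brackets. *)
have E a : muAc A a X Y = muAc A 0 X Y - a *: (inner (Kmx *m X) Y *: evec 1).
  by apply/colP => k; rewrite !muAcE !col_lin; ring.
have h : muAc A 0 X Y - c t *: (inner (Kmx *m X) Y *: evec 1) @[t --> +oo]
    --> muAc A 0 X Y - 0 *: (inner (Kmx *m X) Y *: evec 1).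
  by apply: cvgB; [exact: cvg_cst|apply: cvgZ;
    [exact: cvg_flow_coef|exact: cvg_cst]].
by rewrite scale0r subr0 in h; under eq_fun do rewrite E.
Qed.

End Flow.

Theorem theorem5p3 (R : realType) (n : nat) (A0 : 'M[R]_(2 * n)) (c0 : R)
    (hn : (2 <= n)%N) (hA0 : admissible A0) (hc0 : c0 != 0)
    (hskt : skt (muAc A0 c0))
    (han : almost_nilpotent (muAc A0 c0))
    (hsu : strongly_unimodular (muAc A0 c0)) :
  let c := fun t : R => c0 / Num.sqrt (1 + 2 * c0 ^+ 2 * t) in
  the_bracket_flow (muAc A0 c0) [set t | - (2 * c0 ^+ 2)^-1 < t]
    (fun t => muAc A0 (c t)) /\
  exists mu_inf : bracket R n,
    [/\ forall X Y, muAc A0 (c t) X Y @[t --> +oo] --> mu_inf X Y,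
        is_lie mu_inf, flat mu_inf, kahler mu_inf & almost_abelian mu_inf].
Proof.
move=> c; split.
  by split; [exact: muAc_bracket_flow|exact: muAc_flow_maximal].
exists (muAc A0 0); split.
- exact: muAc_cvg.
- exact: muAc_lie.
- exact: muA0_flat.
- exact: muA0_kahler.
- exact: muA0_almost_abelian.
Qed.
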